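(* Let $A$ be a real $n \times n$ matrix and $0 < \theta < \frac{\pi}{2}$. If $A$ is diagonally $\mathbb{C}^0_\theta$-stable, then $A$ is both relatively $D$-stable and relatively additive $D$-stable, for the same value of $\theta$.
   Context: For $0 < \theta < \frac{\pi}{2}$ let $\mathbb{C}^0_{\theta} = \{z = x+iy \in \mathbb{C} : x < 0,\ x\tan\theta < y < -x\tan\theta\}$. $\sigma(M)$ denotes the set of (complex) eigenvalues of $M$. A positive (nonnegative) diagonal matrix is a diagonal matrix with all diagonal entries $>0$ ($\geq 0$). For a given $\theta$, a real $n\times n$ matrix $M$ is called: - relatively $D$-stable if $\sigma(DM) \subset \mathbb{C}^0_\theta$ for every positive diagonal matrix $D$; - relatively additive $D$-stable if $\sigma(M - D) \subset \mathbb{C}^0_\theta$ for every nonnegative diagonal matrix $D$; - diagonally $\mathbb{C}^0_\theta$-stable if there exists a positive diagonal matrix $D$ such that the symmetric $2n \times 2n$ matrix $$W(M,D) = \begin{pmatrix} \sin(\theta) DM & \cos(\theta) DM \\ -\cos(\theta) DM & \sin(\theta) DM \end{pmatrix} + \begin{pmatrix} \sin(\theta) M^T D & -\cos(\theta) M^T D \\ \cos(\theta) M^T D & \sin(\theta) M^T D \end{pmatrix}$$ is negative definite. *)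

(* Defs.v *)
From mathcomp Require Import all_boot all_order all_algebra.
From mathcomp Require Import complex.
From mathcomp Require Import all_classical all_reals all_analysis.

Set Implicit Arguments.
Unset Strict Implicit.
Unset Printing Implicit Defensive.

Import Order.TTheory GRing.Theory Num.Theory.

Local Open Scope classical_set_scope.
Local Open Scope ring_scope.

Definition open_sector (R : realType) (theta : R) : set R[i] :=
  [set z | complex.Re z < 0 /\
           complex.Re z * tan theta < complex.Im z < - complex.Re z * tan theta].

(* The complex spectrum of a real matrix: [eigenvalue] is taken over [R[i]],
   not over [R]. *)
Definition spectrum (R : realType) (n : nat) (M : 'M[R]_n) : set R[i] :=
  [set z | eigenvalue (map_mx (real_complex R) M) z].

Definition positive_diag (R : realType) (n : nat) (D : 'M[R]_n) : Prop :=
  is_diag_mx D /\ forall i : 'I_n, 0 < D i i.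

Definition nonnegative_diag (R : realType) (n : nat) (D : 'M[R]_n) : Prop :=
  is_diag_mx D /\ forall i : 'I_n, 0 <= D i i.

(* Only applied to the symmetric matrices [lyapunov_block] below. *)
Definition negative_definite (R : realType) (n : nat) (W : 'M[R]_n) : Prop :=
  forall v : 'cV[R]_n, v != 0 -> (v^T *m W *m v) 0 0 < 0.

Definition relatively_D_stable (R : realType) (theta : R) (n : nat)
    (M : 'M[R]_n) : Prop :=
  forall D : 'M[R]_n, positive_diag D ->
    spectrum (D *m M) `<=` open_sector theta.

Definition relatively_additive_D_stable (R : realType) (theta : R) (n : nat)
    (M : 'M[R]_n) : Prop :=
  forall D : 'M[R]_n, nonnegative_diag D ->
    spectrum (M - D) `<=` open_sector theta.

Definition lyapunov_block (R : realType) (theta : R) (n : nat)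
    (M D : 'M[R]_n) : 'M[R]_(n + n) :=
  block_mx (sin theta *: (D *m M)) (cos theta *: (D *m M))
           (- (cos theta *: (D *m M))) (sin theta *: (D *m M))
  + block_mx (sin theta *: (M^T *m D)) (- (cos theta *: (M^T *m D)))
             (cos theta *: (M^T *m D)) (sin theta *: (M^T *m D)).

Lemma lyapunov_block_sym (R : realType) (theta : R) (n : nat)
    (M D : 'M[R]_n) :
  is_diag_mx D -> (lyapunov_block theta M D)^T = lyapunov_block theta M D.
Proof.
move=> /is_diag_mxP Ddiag.
have DT : D^T = D.
  apply/matrixP => i j; rewrite mxE.
  have [->//|ij] := eqVneq i j.
  by rewrite !Ddiag // eq_sym.
rewrite /lyapunov_block linearD /= !tr_block_mx !linearN /= !linearZ /=.
by rewrite !trmx_mul trmxK DT addrC.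
Qed.

Definition diagonally_sector_stable (R : realType) (theta : R) (n : nat)
    (M : 'M[R]_n) : Prop :=
  exists D : 'M[R]_n,
    positive_diag D /\ negative_definite (lyapunov_block theta M D).

(* Main.v *)
Require Import Defs.
From mathcomp Require Import all_boot all_order all_algebra.
From mathcomp Require Import complex ring lra.
From mathcomp Require Import all_classical all_reals all_analysis.

(** If [M (x + i y) = (a + i b) (x + i y)], then evaluating the quadratic form
    of [W(M, P)] at [(x, y)] and [(x, -y)] gives [2 q (a sin theta + b cos theta)]
    and [2 q (a sin theta - b cos theta)], where [q = x^T P x + y^T P y > 0].
    Hence negative definiteness puts [a + i b] in the open sector.  Moreover
    [W(D M, P D^-1) = W(M, P)], and the form of [W(M - D, P)] lies below that
    of [W(M, P)], so diagonal stability of [A] passes to [D A] and [A - D]. *)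

Import Order.TTheory GRing.Theory Num.Theory.

Local Open Scope ring_scope.

(** [eigenvalue] speaks of row eigenvectors, whereas the quadratic form acts on columns. The passage
    is free because a square matrix and its transpose are invertible together. *)
Lemma eigenvalue_tr (F : fieldType) (n : nat) (M : 'M[F]_n) (a : F) :
  eigenvalue M^T a = eigenvalue M a.
Proof.
rewrite /eigenvalue /eigenspace !kermx_eq0 !row_free_unit -unitmx_tr.
by rewrite linearB /= trmxK tr_scalar_mx.
Qed.

(** Here [x] and [y] are the real and imaginary parts of a complex eigenvector. As [M] has real
    entries, both parts pass through the product with [M]. *)
Lemma spectrumP (R : realType) (n : nat) (M : 'M[R]_n) (z : R[i]) :
  spectrum M z -> exists x y : 'cV[R]_n,
    [/\ M *m x = complex.Re z *: x - complex.Im z *: y,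
        M *m y = complex.Im z *: x + complex.Re z *: y
      & (x != 0) || (y != 0)].
Proof.
rewrite /spectrum /= -eigenvalue_tr => /eigenvalueP[v vM v0].
exists (map_mx (@complex.Re R) v^T), (map_mx (@complex.Im R) v^T).
have {vM} vM i : \sum_j v 0 j * (M i j)%:C%C = z * v 0 i.
  move/rowP: vM => /(_ i); rewrite !mxE => <-.
  by apply: eq_bigr => j _; rewrite !mxE.
split.
- apply/colP => i; rewrite !mxE.
  have /(congr1 (@complex.Re R)) := vM i.
  rewrite raddf_sum /= => H.
  transitivity (complex.Re (z * v 0 i)).
    rewrite -H; apply: eq_bigr => j _; rewrite !mxE.
    by case: (v 0 j) => a b /=; ring.
  by case: z (v 0 i) {vM H} => a b [c d].
- apply/colP => i; rewrite !mxE.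
  have /(congr1 (@complex.Im R)) := vM i.
  rewrite raddf_sum /= => H.
  transitivity (complex.Im (z * v 0 i)).
    rewrite -H; apply: eq_bigr => j _; rewrite !mxE.
    by case: (v 0 j) => a b /=; ring.
  by case: z (v 0 i) {vM H} => a b [c d] /=; ring.
- apply: contraR v0; rewrite negb_or !negbK => /andP[/eqP x0 /eqP y0].
  apply/eqP/rowP => j; rewrite mxE.
  move/colP: x0 => /(_ j); move/colP: y0 => /(_ j); rewrite !mxE.
  by case: (v 0 j) => a b /= -> ->.
Qed.

(** Two separate arguments are kept because the off-diagonal blocks of [lyapunov_block] pair the
    real part with the imaginary one. *)
Definition bform (R : realType) (n : nat) (B : 'M[R]_n) (x y : 'cV[R]_n) : R :=
  (x^T *m B *m y) 0 0.

Arguments bform {R n}.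

Lemma bform_tr (R : realType) (n : nat) (B : 'M[R]_n) (x y : 'cV[R]_n) :
  bform B^T x y = bform B y x.
Proof.
have -> : bform B y x = (y^T *m B *m x)^T 0 0 by rewrite mxE.
by rewrite !trmx_mul trmxK mulmxA.
Qed.

(** Since [M^T P = (P M)^T], the second block matrix is the transpose of the first and contributes
    the same value, whence the factor 2. *)
Lemma lyapunov_bform (R : realType) (theta : R) (n : nat) (M P : 'M[R]_n)
    (x y : 'cV[R]_n) : is_diag_mx P ->
  bform (lyapunov_block theta M P) (col_mx x y) (col_mx x y) =
  2 * (sin theta * (bform (P *m M) x x + bform (P *m M) y y)
     + cos theta * (bform (P *m M) x y - bform (P *m M) y x)).
Proof.
move=> Pd; have PT : P^T = P by case/diag_mxP: Pd => d ->; exact: tr_diag_mx.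
have MP : M^T *m P = (P *m M)^T by rewrite trmx_mul PT.
rewrite /bform /lyapunov_block MP; set B := P *m M.
have eD (U V : 'M[R]_1) : (U + V) 0 0 = U 0 0 + V 0 0 by rewrite mxE.
have eN (U : 'M[R]_1) : (- U) 0 0 = - U 0 0 by rewrite mxE.
have eZ c (U : 'M[R]_1) : (c *: U) 0 0 = c * U 0 0 by rewrite mxE.
rewrite tr_col_mx mulmxDr !mul_row_block mulmxDl !mul_row_col.
rewrite !(mulmxDl, mulmxN, mulNmx) -!scalemxAr -!scalemxAl.
rewrite !(eD, eN, eZ) -!/(bform _ _ _) !bform_tr; ring.
Qed.

Lemma bformDl (R : realType) (n : nat) (B C : 'M[R]_n) (x y : 'cV[R]_n) :
  bform (B + C) x y = bform B x y + bform C x y.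
Proof. by rewrite /bform mulmxDr mulmxDl mxE. Qed.

Lemma bformNl (R : realType) (n : nat) (B : 'M[R]_n) (x y : 'cV[R]_n) :
  bform (- B) x y = - bform B x y.
Proof. by rewrite /bform mulmxN mulNmx mxE. Qed.

Lemma bformNr (R : realType) (n : nat) (B : 'M[R]_n) (x y : 'cV[R]_n) :
  bform B x (- y) = - bform B x y.
Proof. by rewrite /bform mulmxN mxE. Qed.

Lemma bformNm (R : realType) (n : nat) (B : 'M[R]_n) (x y : 'cV[R]_n) :
  bform B (- x) y = - bform B x y.
Proof. by rewrite /bform linearN /= !mulNmx mxE. Qed.

Lemma bform_mulr (R : realType) (n : nat) (P M : 'M[R]_n)
    (x y u v : 'cV[R]_n) (a b : R) :
  M *m y = a *: u + b *: v ->
  bform (P *m M) x y = a * bform P x u + b * bform P x v.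
Proof.
by move=> H; rewrite /bform !mulmxA -(mulmxA _ M) H mulmxDr -!scalemxAr !mxE.
Qed.

Lemma bform_diag (R : realType) (n : nat) (P : 'M[R]_n) (x : 'cV[R]_n) :
  is_diag_mx P -> bform P x x = \sum_i P i i * x i 0 ^+ 2.
Proof.
case/diag_mxP => d ->; rewrite /bform mxE; apply: eq_bigr => i _.
by rewrite mul_mx_diag !mxE eqxx mulr1n mulrAC mulrC -expr2.
Qed.

Lemma bform_nonneg (R : realType) (n : nat) (P : 'M[R]_n) (x : 'cV[R]_n) :
  nonnegative_diag P -> 0 <= bform P x x.
Proof.
case=> Pd P0; rewrite bform_diag//; apply: sumr_ge0 => i _.
by rewrite mulr_ge0 ?sqr_ge0.
Qed.

Lemma bform_pos (R : realType) (n : nat) (P : 'M[R]_n) (x : 'cV[R]_n) :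
  positive_diag P -> x != 0 -> 0 < bform P x x.
Proof.
case=> Pd P0 /cV0Pn[i xi0]; rewrite bform_diag// (bigD1 i)//=.
apply: ltr_pwDl; first by rewrite mulr_gt0 ?exprn_even_gt0.
by apply: sumr_ge0 => j _; rewrite mulr_ge0 ?sqr_ge0 ?ltW.
Qed.

(** Lyapunov-type criterion behind both claims: for each perturbed matrix it remains only to exhibit
    a suitable diagonal [P]. *)
Lemma lyapunov_spectrum (R : realType) (theta : R) (n : nat) (M P : 'M[R]_n) :
  0 < theta -> theta < pi / 2 -> positive_diag P ->
  negative_definite (lyapunov_block theta M P) ->
  (spectrum M `<=` open_sector theta)%classic.
Proof.
move=> t0 t2 Ppos W z /spectrumP[x [y [Mx My xy0]]].
have s0 : 0 < sin theta by rewrite sin_gt0_pihalf ?t0.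
have c0 : 0 < cos theta by rewrite cos_gt0_pihalf// t2 andbT; lra.
have q0 : 0 < bform P x x + bform P y y.
  have Pnn : nonnegative_diag P by case: Ppos => ? P0; split=> // i; exact: ltW.
  case/orP: xy0 => ne0; first by rewrite ltr_pwDl ?bform_pos ?bform_nonneg.
  by rewrite ltr_wpDl ?bform_pos ?bform_nonneg.
have col0 u : (u == y) || (u == - y) -> col_mx x u != 0.
  move=> uy; rewrite col_mx_eq0 negb_and.
  by case/orP: uy => /eqP ->; rewrite ?oppr_eq0.
rewrite -scaleNr in Mx.
have PT : P^T = P by case: Ppos => /diag_mxP[d ->] _; exact: tr_diag_mx.
(* With [P] symmetric, the mixed terms [x^T P y] cancel and only multiples of [q] survive. *)
have sym : bform P y x = bform P x y by rewrite -{1}PT bform_tr.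
(* Replacing [y] by [- y] conjugates the eigenvector; the two evaluations yield the two edges of the
   sector. *)
have := W _ (col0 y _); have := W _ (col0 (- y) _).
rewrite !eqxx orbT => /(_ isT) + /(_ isT).
rewrite -!/(bform _ _ _) !lyapunov_bform ?(proj1 Ppos)//.
rewrite !(bformNr, bformNm) !(bform_mulr _ _ _ _ _ _ _ _ _ _ Mx).
rewrite !(bform_mulr _ _ _ _ _ _ _ _ _ _ My) sym.
move: q0 s0 c0; rewrite /open_sector /= /tan.
move: (bform P x x) (bform P y y) (bform P x y) => p r t.
move: (complex.Re z) (complex.Im z) (sin theta) (cos theta) => a b s c.
move=> q0 s0 c0 H1 H2.
have {}H1 : a * s - b * c < 0.
  by rewrite -(pmulr_rlt0 _ q0); move: H1; lra.
have {}H2 : a * s + b * c < 0.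
  by rewrite -(pmulr_rlt0 _ q0); move: H2; lra.
(* The sum of [H1] and [H2] is [2 a s < 0], so [a < 0]. Multiplied by [c > 0], the lower bound on
   [b] is [H1] and the upper one is [H2]. *)
split; first by nra.
by rewrite !mulrA ltr_pdivrMr// ltr_pdivlMr//; apply/andP; split; lra.
Qed.

Theorem theorem6 (R : realType) (n : nat) (A : 'M[R]_n) (theta : R)
    (theta_gt0 : 0 < theta) (theta_lt : theta < pi / 2) :
  diagonally_sector_stable theta A ->
  relatively_D_stable theta A /\ relatively_additive_D_stable theta A.
Proof.
case=> P [Ppos W]; have [Pd P0] := Ppos; split=> D [Dd D0].
- have [p eP] := diag_mxP _ Pd; have [d eD] := diag_mxP _ Dd.
  have p0 i : 0 < p 0 i by have := P0 i; rewrite eP mxE eqxx.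
  have d0 i : 0 < d 0 i by have := D0 i; rewrite eD mxE eqxx.
  pose Q := diag_mx (\row_i (p 0 i / d 0 i)).
  have QD : Q *m D = P.
    rewrite eD eP mulmx_diag; congr diag_mx; apply/rowP => i.
    by rewrite !mxE divfK ?gt_eqF.
  (* The other order of the product serves the transposed blocks, where [(D A)^T Q = A^T D Q]. *)
  have DQ : D *m Q = P by rewrite -QD eD diag_mxC.
  apply: (lyapunov_spectrum _ _ _ _ Q) => //.
    split=> [|i]; first exact: diag_mx_is_diag.
    by rewrite !mxE eqxx mulr1n divr_gt0.
  have DT : D^T = D by rewrite eD tr_diag_mx.
  by rewrite /lyapunov_block trmx_mul DT mulmxA QD -(mulmxA _ D) DQ.
(* The additive case keeps the same [P]. *)
- apply: (lyapunov_spectrum _ _ _ _ P) => // v v0.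
  apply: le_lt_trans (W v v0).
  rewrite -!/(bform _ _ _) -(vsubmxK v) !lyapunov_bform//.
  have s0 : 0 < sin theta by rewrite sin_gt0_pihalf ?theta_gt0.
  have [p eP] := diag_mxP _ Pd; have [d eD] := diag_mxP _ Dd.
  have PDnn : nonnegative_diag (P *m D).
    rewrite eP eD mulmx_diag; split=> [|i]; first exact: diag_mx_is_diag.
    rewrite !mxE eqxx mulr1n mulr_ge0 //.
      by have := P0 i; rewrite eP mxE eqxx => /ltW.
    by have := D0 i; rewrite eD mxE eqxx.
  have sym x y : bform (P *m D) x y = bform (P *m D) y x.
    by rewrite -bform_tr eP eD mulmx_diag tr_diag_mx.
  (* Symmetry of [P D] removes its cosine terms. With [x], [y] the halves of [v], the two forms
     differ by [2 sin theta (x^T P D x + y^T P D y)], which is nonnegative. *)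
  rewrite mulmxBr !(bformDl, bformNl) (sym (dsubmx v) (usubmx v)).
  have := mulr_ge0 (ltW s0) (bform_nonneg _ _ _ (usubmx v) PDnn).
  have := mulr_ge0 (ltW s0) (bform_nonneg _ _ _ (dsubmx v) PDnn).
  lra.
Qed.
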